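(* For every $\omega\in\Omega_+$, every finitely presented group admitting an epimorphism onto $G_\omega$ is large.
   Context: $\Omega=\{0,1,2\}^{\mathbf N}$, sequences $\omega=(\omega_1,\omega_2,\dots)$; $\Omega_+$ is the set of sequences that are not eventually constant; $\sigma$ is the shift $(\sigma\omega)_n=\omega_{n+1}$. On the binary tree $X^*$, $X=\{0,1\}$, let $a$ be the automorphism $a(0w)=1w$, $a(1w)=0w$. Set $a_{\beta(0)}=a_{\beta(1)}=a$, $a_{\beta(2)}=1$; $a_{\gamma(0)}=a_{\gamma(2)}=a$, $a_{\gamma(1)}=1$; $a_{\delta(1)}=a_{\delta(2)}=a$, $a_{\delta(0)}=1$. For each $\omega$, define automorphisms $b_\omega,c_\omega,d_\omega$ of $X^*$ recursively by $b_\omega(0w)=0\,a_{\beta(\omega_1)}(w)$, $b_\omega(1w)=1\,b_{\sigma\omega}(w)$, and similarly $c_\omega$ with $a_{\gamma(\omega_1)},c_{\sigma\omega}$, and $d_\omega$ with $a_{\delta(\omega_1)},d_{\sigma\omega}$. $G_\omega=\langle a,b_\omega,c_\omega,d_\omega\rangle$. (E.g. $\omega=012012\dots$ gives the Grigorchuk group.) A group is large if it has a finite-index subgroup admitting an epimorphism onto a non-abelian free group. *)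

(* Defs.v *)
From mathcomp Require Import all_boot.
Set Implicit Arguments. Unset Strict Implicit. Unset Printing Implicit Defensive.

Structure group := Group {
  gcarrier :> Type;
  gmul : gcarrier -> gcarrier -> gcarrier;
  ginv : gcarrier -> gcarrier;
  gone : gcarrier;
  gmulA : forall x y z, gmul x (gmul y z) = gmul (gmul x y) z;
  gmul1 : forall x, gmul gone x = x;
  gmulV : forall x, gmul (ginv x) x = gone
}.

(* a letter (x, false) stands for x, (x, true) for x^-1 *)
Definition word (X : Type) := seq (X * bool).

Definition winv (X : Type) (w : word X) : word X :=
  rev (map (fun l => (l.1, ~~ l.2)) w).

Definition push (X : eqType) (l : X * bool) (s : word X) : word X :=
  match s with
  | l' :: s' => if (l'.1 == l.1) && (l'.2 == ~~ l.2) then s' else l :: s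
  | [::] => [:: l]
  end.

Definition reduce (X : eqType) (w : word X) : word X := foldr (@push X) [::] w.

(* reduced words: no subword x x^-1 or x^-1 x; these are the elements of the
   free group F(X), with product reduce (u ++ v), inverse winv, unit [::] *)
Fixpoint reduced (X : eqType) (w : word X) : bool :=
  match w with
  | l :: ((l' :: _) as s) => ~~ ((l'.1 == l.1) && (l'.2 == ~~ l.2)) && reduced s
  | _ => true
  end.

Definition eval_word (G : group) (X : Type) (gens : X -> G) (w : word X) : G :=
  foldr (fun l acc => gmul (if l.2 then ginv (gens l.1) else gens l.1) acc) (gone G) w.

Definition in_normal_closure (X : eqType) (R : seq (word X)) (w : word X) : Prop :=
  exists s : seq (word X * word X * bool),
    (forall t, t \in s -> t.1.2 \in R) /\
    reduce w = reduce (flatten (map (fun t =>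
       t.1.1 ++ (if t.2 then winv t.1.2 else t.1.2) ++ winv t.1.1) s)).

Definition finitely_presented (G : group) : Prop :=
  exists (n : nat) (gens : 'I_n -> G) (R : seq (word 'I_n)),
    (forall g : G, exists w : word 'I_n, eval_word gens w = g) /\
    (forall w : word 'I_n, eval_word gens w = gone G <-> in_normal_closure R w).

Definition subgroup (G : group) (H : G -> Prop) : Prop :=
  H (gone G) /\ (forall x y, H x -> H y -> H (gmul x y)) /\ (forall x, H x -> H (ginv x)).

Definition finite_index (G : group) (H : G -> Prop) : Prop :=
  exists (k : nat) (r : 'I_k -> G), forall g : G, exists i h, H h /\ g = gmul (r i) h.

Definition epi_onto_free (G : group) (H : G -> Prop) (X : eqType)
    (phi : G -> word X) : Prop :=
  (forall h, H h -> reduced (phi h)) /\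
  (forall x y, H x -> H y -> phi (gmul x y) = reduce (phi x ++ phi y)) /\
  (forall f : word X, reduced f -> exists h, H h /\ phi h = f).

Definition large (G : group) : Prop :=
  exists H : G -> Prop, subgroup H /\ finite_index H /\
    exists (X : eqType) (x1 x2 : X), x1 <> x2 /\
      exists phi : G -> word X, epi_onto_free H phi.

(* vertices of the binary tree X^*, X = {0,1} = {false,true} *)
Definition vtx := seq bool.

Definition a_aut (w : vtx) : vtx :=
  match w with x :: w' => ~~ x :: w' | [::] => [::] end.

(* omega = (omega_1, omega_2, ...) is represented by om : nat -> 'I_3 with
   om 0 = omega_1 *)
Definition Omega := nat -> 'I_3.
Definition shift (om : Omega) : Omega := fun n => om n.+1.

Definition not_eventually_constant (om : Omega) : Prop :=
  ~ (exists N, forall n, N <= n -> om n = om N).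

Definition a_beta (i : 'I_3) : vtx -> vtx := if val i == 2 then id else a_aut.
Definition a_gamma (i : 'I_3) : vtx -> vtx := if val i == 1 then id else a_aut.
Definition a_delta (i : 'I_3) : vtx -> vtx := if val i == 0 then id else a_aut.

Fixpoint rec_aut (ax : 'I_3 -> vtx -> vtx) (om : Omega) (w : vtx) : vtx :=
  match w with
  | [::] => [::]
  | false :: w' => false :: ax (om 0) w'
  | true :: w' => true :: rec_aut ax (shift om) w'
  end.

Definition b_aut := rec_aut a_beta.
Definition c_aut := rec_aut a_gamma.
Definition d_aut := rec_aut a_delta.

(* elements of G_om = <a, b_om, c_om, d_om> (composition of automorphisms;
   the generators are involutions, so the generated monoid is the group) *)
Inductive in_Gom (om : Omega) : (vtx -> vtx) -> Prop :=
  | Gom_id : in_Gom om id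
  | Gom_a : in_Gom om a_aut
  | Gom_b : in_Gom om (b_aut om)
  | Gom_c : in_Gom om (c_aut om)
  | Gom_d : in_Gom om (d_aut om)
  | Gom_comp : forall f g, in_Gom om f -> in_Gom om g -> in_Gom om (f \o g).

Definition epi_onto_Gom (G : group) (om : Omega) (pi : G -> vtx -> vtx) : Prop :=
  (forall x y, pi (gmul x y) =1 pi x \o pi y) /\
  (forall x, exists f, in_Gom om f /\ pi x =1 f) /\
  (forall f, in_Gom om f -> exists x, pi x =1 f).

(* Main.v *)
(* A word in a, b, c, d acting trivially on the tree has, at every vertex of
   some deep level N, a section that is already trivial in Gamma = C_2 * V_4
   (contraction).  Hence only finitely many levels are needed to kill the finitely
   many relators of a finitely presented cover G of G_omega, so G acts on the
   N-level tree whose leaves carry copies of any Gamma-set, compatibly with the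
   sections.  Take for it a Gamma-set on which a finite-index subgroup of
   Gamma acts through a map onto a free group of rank 2: the subgroup of G
   fixing the vertex 1^N and the finite part of the label then maps onto that
   free group, because the sections at 1^N of its stabilizer exhaust Gamma. *)
Require Import Defs.
From mathcomp Require Import all_boot zify.
From Stdlib Require Import ClassicalEpsilon.
Set Implicit Arguments. Unset Strict Implicit. Unset Printing Implicit Defensive.

(** * Free reduction and the free group of reduced words *)

Lemma foldr_push (X : eqType) (T : Type) (F : X * bool -> T -> T) :
  (forall l t, F l (F (l.1, ~~ l.2) t) = t) ->
  forall l s t, foldr F t (push l s) = F l (foldr F t s).
Proof.
move=> FK l [|[x e] s] t //=; case: ifP => //= /andP[/eqP-> /eqP->].
by rewrite FK.
Qed.

(** [reduce] only deletes adjacent inverse letters, whose operators cancel. Keeping [F] arbitrary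
    lets this serve the action of substituted words on the labelled tree. *)
Lemma foldr_reduce (X : eqType) (T : Type) (F : X * bool -> T -> T) :
  (forall l t, F l (F (l.1, ~~ l.2) t) = t) ->
  forall w t, foldr F t (reduce w) = foldr F t w.
Proof. by move=> FK; elim=> //= l w IH t; rewrite foldr_push ?IH. Qed.

Section FreeGroup.
Variable X : eqType.

Lemma reduced_tail (l : X * bool) s : reduced (l :: s) -> reduced s.
Proof. by case: s => //= l' s /andP[]. Qed.

Lemma reduced_push l (s : word X) : reduced s -> reduced (push l s).
Proof.
case: s => [|l' s] // red_s; rewrite /push.
case: ifP => [_|h]; first exact: reduced_tail red_s.
by rewrite /= in red_s *; rewrite h.
Qed.

Lemma push_reduced l (s : word X) : reduced (l :: s) -> push l s = l :: s.
Proof. by case: s => //= l' s /andP[/negbTE->]. Qed.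

Lemma reduce_id (s : word X) : reduced s -> reduce s = s.
Proof.
elim: s => //= l s IH red_s.
by rewrite IH ?(reduced_tail red_s) ?push_reduced.
Qed.

Lemma pushK l (s : word X) : reduced s -> push l (push (l.1, ~~ l.2) s) = s.
Proof.
case: l => x e; case: s => [|[y f] s] red_s /=; first by rewrite !eqxx.
rewrite negbK; case: ifP => [/andP[/eqP yx /eqP fe]|_]; last by rewrite /= !eqxx.
by rewrite yx fe in red_s *; rewrite push_reduced.
Qed.

Definition free := {s : word X | reduced s}.

Definition fone : free := exist _ [::] isT.
Definition fpush l (f : free) : free :=
  exist _ (push l (val f)) (reduced_push l (valP f)).
(** Multiplying letter by letter from the left makes right translation commute with every
    [fpush]. *)
Definition fmul (f g : free) : free := foldr fpush g (val f).

Lemma fpushK l f : fpush l (fpush (l.1, ~~ l.2) f) = f.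
Proof. by apply: val_inj; rewrite /= pushK ?(valP f). Qed.

Lemma fmul_fpush l f g : fmul (fpush l f) g = fpush l (fmul f g).
Proof. by rewrite /fmul foldr_push //; apply: fpushK. Qed.

Lemma val_fmul f g : val (fmul f g) = reduce (val f ++ val g).
Proof.
rewrite /fmul /reduce foldr_cat -/(reduce (val g)) reduce_id ?(valP g) //.
by elim: (val f) => //= l s ->.
Qed.

End FreeGroup.

(** * Group identities and evaluation of words *)

Section GroupFacts.
Variable G : group.
Implicit Types x y : G.

Lemma gmulKV x y : gmul (ginv x) (gmul x y) = y.
Proof. by rewrite gmulA gmulV gmul1. Qed.

Lemma gmulxV x : gmul x (ginv x) = gone G.
Proof.
by rewrite -{1}(gmulKV (ginv x) x) gmulV -gmulA gmul1 gmulV.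
Qed.

Lemma gmulK x y : gmul x (gmul (ginv x) y) = y.
Proof. by rewrite gmulA gmulxV gmul1. Qed.

Lemma gmulx1 x : gmul x (gone G) = x.
Proof. by rewrite -(gmulV x) gmulK. Qed.

Variables (X : Type) (gens : X -> G).

Lemma eval_word_cat (u v : word X) :
  eval_word gens (u ++ v) = gmul (eval_word gens u) (eval_word gens v).
Proof. by elim: u => [|l u IH] /=; rewrite ?gmul1 // IH gmulA. Qed.

Lemma winv_cons l (w : word X) : winv (l :: w) = winv w ++ [:: (l.1, ~~ l.2)].
Proof. by rewrite /winv map_cons rev_cons cats1. Qed.

Lemma eval_winv (w : word X) : gmul (eval_word gens (winv w)) (eval_word gens w) = gone G.
Proof.
elim: w => [|[x e] w IH]; first by rewrite gmul1.
rewrite winv_cons eval_word_cat /= gmulx1 -gmulA.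
by case: e => /=; rewrite ?gmulKV ?gmulK.
Qed.

End GroupFacts.

(* The Klein four-group <b, c, d> is written additively as F_2^2 with
   b = (1,0), c = (0,1), d = (1,1); the value of b, c or d on the subtree at 0
   is then a^chi for one of the three nonzero characters chi. *)
Notation klein := (bool * bool)%type.

(** * The Klein four-group and its characters *)

Definition kadd (p q : klein) : klein := (p.1 (+) q.1, p.2 (+) q.2).
Definition k0 : klein := (false, false).

Definition chi (i : 'I_3) (p : klein) : bool :=
  match val i with 0 => p.1 (+) p.2 | 1 => p.1 | _ => p.2 end.

Lemma kaddpp p : kadd p p = k0.
Proof. by case: p => [[] []]. Qed.

Lemma kadd0p p : kadd k0 p = p.
Proof. by case: p => [[] []]. Qed.

Lemma kaddA p q r : kadd p (kadd q r) = kadd (kadd p q) r.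
Proof. by rewrite /kadd /= !addbA. Qed.

Lemma chi_kadd i p q : chi i (kadd p q) = chi i p (+) chi i q.
Proof.
by rewrite /chi /kadd /=; case: (val i) => [|[|?]] //=;
   case: p q => [[] []] [[] []].
Qed.

Lemma chi0 i : chi i k0 = false.
Proof. by rewrite /chi; case: (val i) => [|[|?]]. Qed.

Lemma chi_surj i : exists p, chi i p.
Proof.
by rewrite /chi; case: (val i) => [|[|?]];
  [exists (true, false) | exists (true, false) | exists (false, true)].
Qed.

(** The kernels of the three nonzero characters have order two and meet pairwise only in [k0]. *)
Lemma chi_inj i j p : p != k0 -> chi i p = false -> chi j p = false -> i = j.
Proof.
move=> pn0 hi hj; apply: val_inj; move: hi hj; rewrite /chi.
case: i j => [[|[|[|?]]] //= ?] [[|[|[|?]]] //= ?];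
by case: p pn0 => [[] []].
Qed.

(* [None] is the generator a and [Some p] an element of the Klein group, so
   words in [letter] represent elements of the free product C_2 * V_4. *)
Notation letter := (option klein).

Definition tact (om : Omega) (l : letter) : vtx -> vtx :=
  if l is Some p then rec_aut (fun i => if chi i p then a_aut else id) om
  else a_aut.

Definition twact om (w : seq letter) (v : vtx) : vtx := foldr (tact om) v w.

(* C_2 * V_4 acts on [leaf] through the regular action of C_2 x V_4 on the
   states (q, s), with a free-group valued cocycle: a at the state (q, s) also
   multiplies by x_q or x_q^-1 according to s, where x_b and x_c are free
   generators and x_1 = x_d = 1. *)
Definition leaf := (klein * bool * free bool)%type.

Definition leafA (y : leaf) : leaf :=
  let: (q, s, f) := y in
  (q, ~~ s, if q.1 (+) q.2 then fpush (q.1, s) f else f).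

Definition leafV p (y : leaf) : leaf :=
  let: (q, s, f) := y in (kadd p q, s, f).

Lemma leafAK y : leafA (leafA y) = y.
Proof.
case: y => [[[q1 q2] s] f] /=; rewrite negbK; case: (q1 (+) q2) => //.
by have := fpushK (q1, ~~ s) f; rewrite [_.1]/= [_.2]/= negbK => ->.
Qed.

Lemma leafV_kadd p q y : leafV p (leafV q y) = leafV (kadd p q) y.
Proof. by case: y => [[r s] f] /=; rewrite kaddA. Qed.

Lemma leafV0 y : leafV k0 y = y.
Proof. by case: y => [[r s] f] /=; rewrite kadd0p. Qed.

(** * The action of words on a level of the tree with labelled leaves *)

Definition actA (z : vtx * leaf) : vtx * leaf :=
  if z.1 is x :: v then (~~ x :: v, z.2) else ([::], leafA z.2).

Definition down (x : bool) (z : vtx * leaf) : vtx * leaf := (x :: z.1, z.2).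

(** The recursion of [rec_aut], handing over to the action on [leaf] once the vertex is
    exhausted. *)
Fixpoint actV p (om : Omega) (v : vtx) (y : leaf) : vtx * leaf :=
  match v with
  | [::] => ([::], leafV p y)
  | false :: v' => down false (if chi (om 0) p then actA (v', y) else (v', y))
  | true :: v' => down true (actV p (shift om) v' y)
  end.

Definition act om (l : letter) (z : vtx * leaf) : vtx * leaf :=
  if l is Some p then actV p om z.1 z.2 else actA z.

Definition wact om (w : seq letter) z := foldr (act om) z w.

Lemma wact_cat om u w z : wact om (u ++ w) z = wact om u (wact om w z).
Proof. by rewrite /wact foldr_cat. Qed.

Lemma twact_cat om u w v : twact om (u ++ w) v = twact om u (twact om w v).
Proof. by rewrite /twact foldr_cat. Qed.

Lemma actAK z : actA (actA z) = z.
Proof. by case: z => [[|x v] y] /=; rewrite /actA /= ?negbK ?leafAK. Qed.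

Lemma actV_kadd p q om z :
  act om (Some p) (act om (Some q) z) = act om (Some (kadd p q)) z.
Proof.
case: z => v y /=; elim: v om => [|[] v IH] om /=; first by rewrite leafV_kadd.
  by rewrite IH.
rewrite chi_kadd; case: (chi _ q); case: (chi _ p) => //=.
by rewrite -surjective_pairing actAK.
Qed.

Lemma actV0 om z : act om (Some k0) z = z.
Proof.
case: z => v y /=; elim: v om => [|[] v IH] om /=; first by rewrite leafV0.
  by rewrite IH.
by rewrite chi0.
Qed.

Lemma actK om l z : act om l (act om l z) = z.
Proof.
case: l => [p|]; last exact: actAK.
by rewrite actV_kadd kaddpp actV0.
Qed.

Lemma act_tact om l z : (act om l z).1 = tact om l z.1.
Proof.
case: l z => [p|] [v y]; last by case: v.
by elim: v om => [|[] v IH] om //=; rewrite ?IH //; case: ifP => // _; case: v IH.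
Qed.

Lemma wact_twact om w z : (wact om w z).1 = twact om w z.1.
Proof. by elim: w => //= l w IH; rewrite act_tact IH. Qed.

Lemma size_tact om l v : size (tact om l v) = size v.
Proof.
case: l => [p|]; last by case: v.
elim: v om => [|[] v IH] om //=; first by rewrite IH.
by case: ifP => // _; case: v {IH}.
Qed.

Lemma size_wact om w z : size (wact om w z).1 = size z.1.
Proof. by elim: w => //= l w IH; rewrite act_tact size_tact IH. Qed.

Lemma wact_revK om w z : wact om (rev w) (wact om w z) = z.
Proof.
elim: w z => //= l w IH z.
by rewrite rev_cons -cats1 wact_cat /= actK IH.
Qed.

Lemma wactK_rev om w z : wact om w (wact om (rev w) z) = z.
Proof. by rewrite -{1}(revK w) wact_revK. Qed.

Definition leaf0 : leaf := (k0, false, fone bool).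

Lemma twact_wact om w v : twact om w v = (wact om w (v, leaf0)).1.
Proof. by rewrite wact_twact. Qed.

Lemma twactK_rev om w v : twact om w (twact om (rev w) v) = v.
Proof.
by rewrite -twact_cat twact_wact wact_cat wactK_rev.
Qed.

(** * Alternating normal forms in the free product *)

Definition altletter (l l' : letter) : bool := isSome l != isSome l'.
Definition alternating (w : seq letter) :=
  sorted altletter w && all (predC1 (Some k0)) w.

Lemma alternating_tail l w : alternating (l :: w) -> alternating w.
Proof.
by rewrite /alternating /= => /andP[/path_sorted-> /andP[_ ->]].
Qed.

(** The new letter extends the word, or cancels or merges with its head. Only relations of C_2 * V_4
    are used, so one [w'] serves every [om]. *)
Lemma alternating_cons l w : alternating w ->
  exists w', [/\ alternating w', size w' <= (size w).+1 &
    forall om z, wact om w' z = act om l (wact om w z)].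
Proof.
move=> alt_w; case: l => [p|].
  have [->|pn0] := eqVneq p k0.
    by exists w; split=> // om z; rewrite actV0.
  case: w alt_w => [|[q|] w] alt_w.
  - by exists [:: Some p]; rewrite /alternating /= pn0.
  - have [pq|pqn0] := eqVneq (kadd p q) k0.
      exists w; split; [exact: alternating_tail alt_w | exact: leqW (leqW _) |].
      move=> om z; rewrite [wact om (_ :: _) _]/= -/(act om (Some q) _).
      by rewrite actV_kadd pq actV0.
    exists (Some (kadd p q) :: w); split=> //.
      by move: alt_w; rewrite /alternating /= pqn0; case: w => [|l w] //= /and3P[-> _ ->].
    move=> om z; rewrite [RHS]/= -/(act om (Some q) _) -/(act om (Some p) _).
    by rewrite actV_kadd.
  - exists (Some p :: None :: w); split=> //.
    by move: alt_w; rewrite /alternating /= pn0.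
case: w alt_w => [|[q|] w] alt_w.
- by exists [:: None].
- by exists (None :: Some q :: w).
exists w; split; [exact: alternating_tail alt_w | exact: leqW (leqW _) |].
by move=> om z; rewrite /= actAK.
Qed.

Lemma alternating_exists w : exists w', [/\ alternating w', size w' <= size w &
  forall om z, wact om w' z = wact om w z].
Proof.
elim: w => [|l w [w1 [alt_w1 szw1 ww1]]]; first by exists [::].
have [w2 [alt_w2 szw2 ww2]] := alternating_cons l alt_w1.
exists w2; split=> //; first exact: leq_trans szw2 _.
by move=> om z; rewrite ww2 ww1.
Qed.

(** * Sections of words and contraction *)

Definition lsect (om : Omega) (l : letter) (x : bool) : seq letter :=
  if l is Some p then
    if x then [:: Some p] else if chi (om 0) p then [:: None] else [::]
  else [::].

Definition lroot (l : letter) (x : bool) : bool := if l is Some _ then x else ~~ x.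
Definition wroot (w : seq letter) x := foldr lroot x w.

Fixpoint sect om (w : seq letter) (x : bool) : seq letter :=
  if w is l :: w' then lsect om l (wroot w' x) ++ sect om w' x else [::].

Lemma wact_down om w x z :
  wact om w (down x z) = down (wroot w x) (wact (shift om) (sect om w x) z).
Proof.
elim: w => [|l w IH] //=; rewrite wact_cat IH.
set z' := wact _ _ z; set x' := wroot w x.
case: l => [p|] /=; last by [].
case: x' => //=; rewrite -?surjective_pairing //.
by case: ifP => //=; rewrite -surjective_pairing.
Qed.

(** The generator a has empty sections at both level-one vertices, and a Klein letter contributes at
    most one letter. *)
Lemma size_sect om w x : size (sect om w x) <= count isSome w.
Proof.
elim: w => //= l w IH; rewrite size_cat leq_add //.
by case: l => [p|] //=; case: (wroot w x) => //; case: ifP.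
Qed.

Lemma alternating_count w : sorted altletter w ->
  (count isSome w).*2 <= (size w).+1.
Proof.
(* Charging the extra 1 only to words that start with a Klein letter makes the bound inductive. *)
suff H: sorted altletter w ->
    (count isSome w).*2 <= size w + (if w is Some _ :: _ then 1 else 0).
  by move/H; case: w {H} => [|[p|] w] /=; lia.
elim: w => //= l [|l' w] IH; first by case: l.
move=> /= /andP[ll' /IH] {IH}; move: ll'; rewrite /altletter.
by case: l l' => [p|] [q|] //= _; lia.
Qed.

Lemma not_eventually_constant_shift om :
  not_eventually_constant om -> not_eventually_constant (shift om).
Proof.
by move=> hom [N hN]; apply: hom; exists N.+1 => -[|n] // /hN.
Qed.

Lemma tact_trivial_chi p om : (forall v, tact om (Some p) v = v) ->
  forall n, chi (om n) p = false.
Proof.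
move=> h n; elim: n om h => [|n IH] om h.
  (* The vertex 01 has its second digit flipped exactly when [chi (om 0) p] holds. *)
  by move: (h [:: false; true]) => /=; case: (chi _ _).
by apply: (IH (shift om)) => v; case: (h (true :: v)).
Qed.

(** A nonzero [p] acting trivially is killed by the characters of all [om n]; by [chi_inj] these all
    coincide, so [om] would be constant. *)
Lemma tact_faithful p om : not_eventually_constant om ->
  (forall v, tact om (Some p) v = v) -> p = k0.
Proof.
move=> hom /tact_trivial_chi h; apply/eqP/negPn/negP => pn0.
by apply: hom; exists 0 => n _; apply: chi_inj pn0 (h n) (h 0).
Qed.

(** Labels must be fixed too: this controls the sections at level [N] as permutations of [leaf],
    beyond their action on vertices. *)
Definition trivial_at om w N :=
  forall z : vtx * leaf, size z.1 = N -> wact om w z = z.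

(* An alternating word of length m >= 2 has sections of length at most
   (m + 1)/2 < m, so deep enough sections have length at most 1; those that act
   trivially are empty because omega is not eventually constant. *)
Lemma contraction om w : not_eventually_constant om ->
  (forall v, twact om w v = v) ->
  exists N, forall n, N <= n -> trivial_at om w n.
Proof.
move: {2}(size w) (leqnn (size w)) => m.
elim: m om w => [|m IH] om w szw hom triv_w.
  by case: w szw {triv_w} => //; exists 0.
have [w' [alt_w' szw' ww']] := alternating_exists w.
have {}triv_w v : twact om w' v = v by rewrite twact_wact ww' -twact_wact triv_w.
suff [N hN] : exists N, forall n, N <= n -> trivial_at om w' n.
  by exists N => n /hN hn z szz; rewrite -ww' hn.
have {szw szw'}szw' := leq_trans szw' szw.
have [/size0nil->|w'n0] := eqVneq (size w') 0; first by exists 0.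
have [sz1|szn1] := eqVneq (size w') 1.
  case: w' sz1 alt_w' triv_w {szw' w'n0 ww'} => [|[p|] []] //= _.
    rewrite /alternating /= => pn0 triv_p; exfalso.
    by move: pn0; rewrite (tact_faithful hom triv_p).
  by move=> _ triv_a; have := triv_a [:: true].
have sect_triv x : wroot w' x = x /\ forall v, twact (shift om) (sect om w' x) v = v.
  split=> [|v].
    have := triv_w [:: x]; rewrite twact_wact.
    by rewrite (_ : (_, _) = down x ([::], leaf0)) // wact_down /= => -[].
  have := triv_w (x :: v); rewrite twact_wact.
  by rewrite (_ : (_, _) = down x (v, leaf0)) // wact_down /= twact_wact => -[].
have sect_sz x : size (sect om w' x) <= m.
  have := alternating_count (proj1 (andP alt_w')); have := size_sect om w' x; lia.
have sectN x := IH _ _ (sect_sz x)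
  (not_eventually_constant_shift hom) (proj2 (sect_triv x)).
have [N0 h0] := sectN false; have [N1 h1] := sectN true.
exists (maxn N0 N1).+1 => -[|n] // nN [[|x v] y] //= [szv].
rewrite (_ : (_, _) = down x (v, y)) // wact_down (proj1 (sect_triv x)).
congr down; move: nN; rewrite ltnS geq_max => /andP[n0 n1].
by case: x; [apply: h1 n1 _ _ | apply: h0 n0 _ _].
Qed.

(** * Right translation of the free coordinate and motion of the base point *)

Definition rmul (g : free bool) (z : vtx * leaf) : vtx * leaf :=
  let: (v, (q, s, f)) := z in (v, (q, s, fmul f g)).

Lemma actA_rmul g z : actA (rmul g z) = rmul g (actA z).
Proof.
case: z => [[|x v] [[q s] f]] //=.
by rewrite /actA /=; case: ifP; rewrite // fmul_fpush.
Qed.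

Lemma down_rmul x g z : down x (rmul g z) = rmul g (down x z).
Proof. by case: z => [v [[q s] f]]. Qed.

(** Letters change the free coordinate only by left multiplication, and by an amount that depends on
    the state alone. *)
Lemma act_rmul om l g z : act om l (rmul g z) = rmul g (act om l z).
Proof.
case: l => [p|]; last exact: actA_rmul.
case: z => v [[q s] f] /=; elim: v om => [|[] v IH] om //=.
  by rewrite IH down_rmul.
case: ifP => // _.
rewrite -[RHS]/(rmul g (down false (actA (v, (q, s, f))))) -down_rmul.
by rewrite -actA_rmul.
Qed.

Lemma wact_rmul om w g z : wact om w (rmul g z) = rmul g (wact om w z).
Proof. by elim: w => //= l w ->; rewrite act_rmul. Qed.

Definition state (z : vtx * leaf) : vtx * (klein * bool) := (z.1, z.2.1).

Lemma state_rmul g z : state (rmul g z) = state z.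
Proof. by case: z => [v [[q s] f]]. Qed.

Lemma rmul_state z : z = rmul z.2.2 ((state z).1, ((state z).2, fone bool)).
Proof. by case: z => [v [[q s] f]]. Qed.

(** Points over one state are right translates of each other, so the action descends to states. *)
Lemma wact_state om w z z' : state z = state z' ->
  state (wact om w z) = state (wact om w z').
Proof.
by move=> zz'; rewrite (rmul_state z) (rmul_state z') zz' !wact_rmul !state_rmul.
Qed.

Definition base N f : vtx * leaf := (nseq N true, (k0, false, f)).

Lemma wact_lift_true om u : exists u', forall z,
  wact om u' (down true z) = down true (wact (shift om) u z).
Proof.
have [p hp] := chi_surj (om 0).
elim: u => [|[q|] u [u' hu']]; first by exists [::].
  by exists (Some q :: u') => z; rewrite /= -/(wact _ _ _) hu'.
(* Since [chi (om 0) p] holds, [p] has section a at vertex 0; conjugating by a moves this section to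
   vertex 1. *)
exists [:: None, Some p, None & u'] => z; rewrite /= -/(wact _ _ _) hu' /= hp.
by rewrite -surjective_pairing.
Qed.

Lemma wact_lift om N u : exists u', forall y,
  wact om u' (nseq N true, y) = (nseq N true, (wact om u ([::], y)).2).
Proof.
elim: N om => [|N IH] om.
  exists u => y; rewrite [LHS]surjective_pairing.
  by have /size0nil-> := size_wact om u ([::], y).
have [u1 hu1] := IH (shift om); have [u2 hu2] := wact_lift_true om u1.
exists u2 => y; rewrite [nseq _ _]/= (_ : (_, y) = down true (nseq N true, y)) //.
rewrite hu2 hu1 /down /=; congr pair.
(* At the empty vertex the sequence is never read, so passing to [shift om] does no harm. *)
have om_indep om' : (wact om' u ([::], y)).2 =
    foldr (fun l => if l is Some p then leafV p else leafA) y u.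
  elim: u {IH hu1 u1 hu2 u2} => //= l u <-.
  have /size0nil := size_wact om' u ([::], y); case: (wact _ _ _) => v y' /= ->.
  by case: l.
by rewrite !om_indep.
Qed.

Lemma wact_base_surj om N (f : free bool) :
  exists u, wact om u (base N (fone bool)) = base N f.
Proof.
case: f => s red_s; elim: s red_s => [|[x e] s IH] red_s.
  by exists [::]; congr (_, (_, _)); apply: val_inj.
have [u hu] := IH (reduced_tail red_s).
pose p : klein := (x, ~~ x).
(* A commutator of a and [p]: one a acts over the Klein coordinate [p], where it pushes [x] with the
   sign given by the flag, the other over [k0], where it pushes nothing. State [(k0, false)] is
   restored. *)
pose t := if e then [:: Some p; None; Some p; None] else [:: None; Some p; None; Some p].
have [t' ht'] := wact_lift om N t.
exists (t' ++ u); rewrite wact_cat hu ht' /base; congr pair.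
have pushE : (exist _ ((x, e) :: s) red_s : free bool)
    = fpush (x, e) (exist _ s (reduced_tail red_s)).
  by apply: val_inj; rewrite /= push_reduced.
rewrite pushE /t /p; move: (exist _ s _) => f.
by case: (e); case: (x).
Qed.

(** * Words in letters represent exactly the elements of the tree group *)

Lemma eq_rec_aut ax ax' : (forall i, ax i =1 ax' i) ->
  forall om, rec_aut ax om =1 rec_aut ax' om.
Proof.
by move=> axx om v; elim: v om => [|[] v IH] om //=; rewrite ?IH ?axx.
Qed.

Lemma in_Gom_twact om f : in_Gom om f -> exists w, f =1 twact om w.
Proof.
elim=> [||||| g h _ [u hu] _ [w hw]].
- by exists [::].
- by exists [:: None].
- exists [:: Some (true, false)]; apply: eq_rec_aut => -[[|[|[|?]]] ?] //.
- exists [:: Some (false, true)]; apply: eq_rec_aut => -[[|[|[|?]]] ?] //.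
- exists [:: Some (true, true)]; apply: eq_rec_aut => -[[|[|[|?]]] ?] //.
by exists (u ++ w) => v; rewrite twact_cat /= hw hu.
Qed.

Lemma tact_in_Gom om l : exists2 f, in_Gom om f & f =1 tact om l.
Proof.
case: l => [[[] []]|]; last by exists a_aut => //; apply: Gom_a.
- by exists (d_aut om); [apply: Gom_d | apply: eq_rec_aut => -[[|[|[|?]]] ?]].
- by exists (b_aut om); [apply: Gom_b | apply: eq_rec_aut => -[[|[|[|?]]] ?]].
- by exists (c_aut om); [apply: Gom_c | apply: eq_rec_aut => -[[|[|[|?]]] ?]].
exists id; first exact: Gom_id.
by move=> v; have := act_tact om (Some k0) (v, leaf0); rewrite actV0.
Qed.

Lemma contraction_seq om (ws : seq (seq letter)) : not_eventually_constant om ->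
  (forall w, w \in ws -> forall v, twact om w v = v) ->
  exists N, forall n, N <= n -> forall w, w \in ws -> trivial_at om w n.
Proof.
move=> hom; elim: ws => [|w ws IH] triv_ws; first by exists 0.
have [N hN] := contraction hom (triv_ws w (mem_head _ _)).
have [M hM] : exists N, forall n, N <= n -> forall w, w \in ws -> trivial_at om w n.
  by apply: IH => u wsu; apply: triv_ws; rewrite inE wsu orbT.
exists (maxn N M) => n; rewrite geq_max => /andP[nN nM] u.
by rewrite inE => /predU1P[->|]; [apply: hN | apply: hM].
Qed.

(** * Substituting letter words for generators; consequences of relators *)

Section Substitution.
Variables (om : Omega) (n : nat) (W : 'I_n -> seq letter).

(** All letters act as involutions, so reversal represents the inverse. *)
Definition lsubst (l : 'I_n * bool) : seq letter :=
  if l.2 then rev (W l.1) else W l.1.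
Definition wsubst (w : word 'I_n) : seq letter := flatten (map lsubst w).

Lemma wsubst_cat u w : wsubst (u ++ w) = wsubst u ++ wsubst w.
Proof. by rewrite /wsubst map_cat flatten_cat. Qed.

Lemma wsubst_winv w : wsubst (winv w) = rev (wsubst w).
Proof.
elim: w => //= l w IH; rewrite winv_cons wsubst_cat IH /wsubst /= cats0 rev_cat.
by case: l => i [] //=; rewrite /lsubst /= revK.
Qed.

Lemma wact_wsubst_reduce w z : wact om (wsubst (reduce w)) z = wact om (wsubst w) z.
Proof.
have wsubst_foldr u : wact om (wsubst u) z = foldr (fun l => wact om (lsubst l)) z u.
  by elim: u => //= l u <-; rewrite wact_cat.
rewrite !wsubst_foldr foldr_reduce // => -[i []] t; rewrite /lsubst /=.
  exact: wact_revK.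
exact: wactK_rev.
Qed.

(** Words preserve the level, so conjugates of words trivial on level [N] remain trivial there. *)
Lemma normal_closure_trivial N R w :
  (forall r, r \in R -> trivial_at om (wsubst r) N) ->
  in_normal_closure R w -> trivial_at om (wsubst w) N.
Proof.
move=> triv_R [s [sR red_w]] z szz; rewrite -wact_wsubst_reduce red_w wact_wsubst_reduce.
elim: s sR {red_w} => //= -[[u r] e] s IH sR.
rewrite wsubst_cat wact_cat IH; last by move=> t st; apply: sR; rewrite inE st orbT.
rewrite !wsubst_cat !wact_cat wsubst_winv /=.
set z' := wact om (rev _) z; have szz' : size z'.1 = N by rewrite size_wact.
have rR : r \in R by apply: (sR (u, r, e)); apply: mem_head.
have triv_r := triv_R r rR z' szz'.
suff -> : wact om (wsubst (if e then winv r else r)) z' = z' by rewrite wactK_rev.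
by case: e {sR} => //; rewrite wsubst_winv -{1}triv_r wact_revK.
Qed.

End Substitution.

(** * The action of G on level N and the stabilizer of the base state *)

Section StateStabilizer.
Variables (om : Omega) (G : group) (n : nat) (gens : 'I_n -> G) (W : 'I_n -> seq letter).
Variable N : nat.
Hypothesis gens_gen : forall g, exists w, eval_word gens w = g.
Hypothesis rel_trivial : forall w, eval_word gens w = gone G ->
  trivial_at om (wsubst W w) N.
Hypothesis letter_lift : forall l, exists w, forall z, size z.1 = N ->
  wact om (wsubst W w) z = act om l z.

Definition wordof (g : G) : word 'I_n :=
  proj1_sig (constructive_indefinite_description _ (gens_gen g)).

Lemma wordofK g : eval_word gens (wordof g) = g.
Proof. by rewrite /wordof; case: constructive_indefinite_description. Qed.

Definition gact (g : G) z := wact om (wsubst W (wordof g)) z.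

Lemma size_gact g z : size (gact g z).1 = size z.1.
Proof. exact: size_wact. Qed.

(** Two words for the same element differ by a relation, which is trivial on level [N]; hence the
    choice made by [wordof] is immaterial. *)
Lemma gact_eval w z : size z.1 = N ->
  gact (eval_word gens w) z = wact om (wsubst W w) z.
Proof.
move=> szz; set g := eval_word gens w.
have : eval_word gens (winv w ++ wordof g) = gone G.
  by rewrite eval_word_cat wordofK eval_winv.
move/rel_trivial/(_ z szz); rewrite wsubst_cat wact_cat wsubst_winv -/(gact g z).
by move=> {2}<-; rewrite wactK_rev.
Qed.

Lemma gactM g h z : size z.1 = N -> gact (gmul g h) z = gact g (gact h z).
Proof.
move=> szz; rewrite -{1}(wordofK g) -{1}(wordofK h) -eval_word_cat gact_eval //.
by rewrite wsubst_cat wact_cat.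
Qed.

Lemma gact1 z : size z.1 = N -> gact (gone G) z = z.
Proof. by move=> szz; rewrite -[gone G]/(eval_word gens [::]) gact_eval. Qed.

Lemma gactVK g z : size z.1 = N -> gact (ginv g) (gact g z) = z.
Proof. by move=> szz; rewrite -gactM // gmulV gact1. Qed.

Definition gstate g := state (gact g (base N (fone bool))).
Definition stab (g : G) : Prop := gstate g = state (base N (fone bool)).

Lemma size_base f : size (base N f).1 = N.
Proof. exact: size_nseq. Qed.

Lemma gstateM g h : stab h -> gstate (gmul g h) = gstate g.
Proof.
by move=> hh; rewrite /gstate gactM ?size_base //; apply: wact_state.
Qed.

Lemma stab_gstate g h : gstate g = gstate h -> stab (gmul (ginv g) h).
Proof.
move=> gh; rewrite /stab /gstate gactM ?size_base //.
rewrite -[in RHS](gactVK g (size_base _)).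
exact: wact_state.
Qed.

Lemma stab_subgroup : subgroup stab.
Proof.
have stab1 : stab (gone G) by rewrite /stab /gstate gact1 ?size_base.
split=> //; split=> [x y sx sy | x sx].
  by rewrite /stab gstateM.
by rewrite -(gmulx1 (ginv x)); apply: stab_gstate; rewrite [LHS]sx.
Qed.

Lemma stab_finite_index : finite_index stab.
Proof.
pose T := (N.-tuple bool * (klein * bool))%type.
have reps (t : T) : exists r, forall g,
    gstate g = (val t.1, t.2) -> gstate r = gstate g.
  have [[r hr]|no] := classic (exists g, gstate g = (val t.1, t.2)).
    by exists r => g ->.
  (* For a state outside the orbit the default is harmless, as the condition is vacuous. *)
  by exists (gone G) => g hg; case: no; exists g.
have [r hr] := fin_all_exists reps.
exists #|{: T}|, (fun i => r (enum_val i)) => g.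
have szg : size (gstate g).1 == N by rewrite size_gact size_base.
pose t : T := (Tuple szg, (gstate g).2).
exists (enum_rank t), (gmul (ginv (r t)) g); rewrite enum_rankK gmulK; split=> //.
by apply: stab_gstate; apply: hr; apply: surjective_pairing.
Qed.

Definition stab_free (g : G) : word bool := val (gact g (base N (fone bool))).2.2.

(** Commutation with [rmul] reduces to [f = fone]; [g] thus multiplies the free coordinate on the
    left, whence [stab_free] is multiplicative on [stab]. *)
Lemma gact_stab g f : stab g -> exists2 f0 : free bool,
  stab_free g = val f0 & gact g (base N f) = base N (fmul f0 f).
Proof.
rewrite /stab /gstate /stab_free => sg.
exists (gact g (base N (fone bool))).2.2 => //.
rewrite -[base N f]/(rmul f (base N (fone bool))) /gact wact_rmul -/(gact g _).
by case: (gact g _) sg => [v [[q s] f0]] /= [-> -> ->].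
Qed.

Lemma gact_surj u : exists g, forall z, size z.1 = N -> gact g z = wact om u z.
Proof.
elim: u => [|l u [g hg]]; first by exists (gone G); apply: gact1.
have [w hw] := letter_lift l.
exists (gmul (eval_word gens w) g) => z szz.
by rewrite gactM // hg // gact_eval ?hw ?size_wact.
Qed.

Lemma stab_epi : epi_onto_free stab stab_free.
Proof.
split=> [h _|]; first exact: valP.
split=> [x y sx sy|f red_f].
  have [fy -> hy] := gact_stab (fone bool) sy.
  have [fx -> hx] := gact_stab (fmul fy (fone bool)) sx.
  rewrite /stab_free gactM ?size_base // hy hx /= !val_fmul cats0.
  by rewrite (reduce_id (valP fy)).
have [u hu] := wact_base_surj om N (exist _ f red_f).
have [g hg] := gact_surj u.
by exists g; rewrite /stab /gstate /stab_free hg ?size_base // hu.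
Qed.

Lemma large_stab : large G.
Proof.
exists stab; split; first exact: stab_subgroup.
split; first exact: stab_finite_index.
by exists bool, false, true; split=> //; exists stab_free; apply: stab_epi.
Qed.

End StateStabilizer.

Theorem theorem1p10 (om : Omega) (hom : not_eventually_constant om)
    (G : group) (hG : finitely_presented G)
    (pi : G -> vtx -> vtx) (hpi : epi_onto_Gom om pi) :
  large G.
Proof.
case: hG => n [gens [R [gens_gen relP]]]; case: hpi => piM [pi_in pi_onto].
have pi_word g : exists w, pi g =1 twact om w.
  have [f [/in_Gom_twact[w fw] pif]] := pi_in g.
  by exists w => v; rewrite pif fw.
have [W hW] := fin_all_exists (fun i => pi_word (gens i)).
(* [pi] is only given as multiplicative, but [pi (gone G)] is idempotent and agrees with an
   invertible [twact], so it is the identity. *)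
have pi1 v : pi (gone G) v = v.
  have [w hw] := pi_word (gone G).
  rewrite -{1}(twactK_rev om w v) -hw.
  by rewrite -[LHS]/((pi (gone G) \o pi (gone G)) _) -piM gmul1 hw twactK_rev.
have piV i v : pi (ginv (gens i)) v = twact om (rev (W i)) v.
  rewrite -{1}(twactK_rev om (W i) v) -hW.
  by rewrite -[LHS]/((pi (ginv _) \o pi (gens i)) _) -piM gmulV pi1.
have pi_eval w v : pi (eval_word gens w) v = twact om (wsubst W w) v.
  elim: w => [|[i e] w IH] /=; first exact: pi1.
  by rewrite piM /= IH twact_cat /lsubst; case: e => /=; rewrite ?piV ?hW.
have tactK l v : tact om l (tact om l v) = v.
  exact: (twactK_rev om [:: l]).
have lift l : exists w, forall v, twact om (wsubst W w) v = tact om l v.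
  have [f fG fl] := tact_in_Gom om l; have [g gf] := pi_onto f fG.
  have [w wg] := gens_gen g.
  by exists w => v; rewrite -pi_eval wg gf fl.
have [L hL] := fin_all_exists lift.
(* Besides the relators, a common level must kill the words comparing each letter with its lift:
   these agree on vertices, and contraction extends this to labels. *)
pose ws := [seq wsubst W r | r <- R] ++ [seq wsubst W (L l) ++ [:: l] | l : letter].
have [|N /(_ N (leqnn N)) hN] := @contraction_seq om ws hom.
  move=> w; rewrite mem_cat => /orP[/mapP[r rR ->]|/mapP[l _ ->]] v.
    rewrite -pi_eval (_ : eval_word gens r = gone G) ?pi1 //.
    apply/relP; exists [:: ([::], r, false)]; split.
      by move=> t; rewrite inE => /eqP->.
    by rewrite /= !cats0.
  by rewrite twact_cat hL /= tactK.
apply: (@large_stab om G n gens W N gens_gen) => [w /relP|l].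
  apply: normal_closure_trivial => r rR; apply: hN.
  by rewrite mem_cat map_f.
exists (L l) => z szz.
have lws : wsubst W (L l) ++ [:: l] \in ws.
  by rewrite mem_cat orbC (codom_f (fun l => wsubst W (L l) ++ [:: l])).
(* Evaluating at [act om l z] cancels the trailing involution [l]. *)
have := hN _ lws (act om l z); rewrite wact_cat /= actK => -> //.
by rewrite act_tact size_tact.
Qed.
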